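(* Let $x^*\in\mathcal S\cap\Omega$, and set $g(x):=T(x)$ and $h(x):=E(x^* )B(x)$ for $x\in\mathbb R^n$. If there exists $\epsilon>0$ such that $\partial h(x)\cap\partial g(x^* )\ne\emptyset$ for all $x\in\mathcal B_{\mathcal S\cap\Omega}(x^*,\epsilon)$, then $x^*$ is a local minimizer of $E$.
   Context: Standing assumptions: $T,B:\mathbb R^n\to\mathbb R$ are (finite-valued) convex functions with $T(\alpha x)=\alpha T(x)\ge 0$ and $B(\alpha x)=\alpha B(x)\ge 0$ for all $\alpha\ge 0$, $x\in\mathbb R^n$; moreover $\{x\in\mathbb R^n: B(x)=0\}\cap\{x\in\mathbb R^n: T(x)=0\}=\{0\}$ and $\Omega:=\{x\in\mathbb R^n: B(x)\ne 0\}$ is nonempty. For $x\in\Omega$, $E(x):=T(x)/B(x)$. $\|\cdot\|$ is the Euclidean norm, $\mathcal S:=\{x\in\mathbb R^n:\|x\|=1\}$, and $\partial$ denotes the convex subdifferential, $\partial f(x)=\{v: f(y)\ge f(x)+v^\top(y-x)\ \forall y\in\mathbb R^n\}$. For $x^*\in\mathcal S\cap\Omega$ and $\epsilon>0$, $\mathcal B_{\mathcal S\cap\Omega}(x^*,\epsilon):=\{x\in\mathcal S\cap\Omega:\|x-x^*\|\le\epsilon\}$. A point $x^*\in\mathcal S\cap\Omega$ is a local minimizer of $E$ if there is $\epsilon>0$ such that $E(x)\ge E(x^* )$ for all $x\in\mathcal B_{\mathcal S\cap\Omega}(x^*,\epsilon)$. *)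

(* Defs.v *)
From mathcomp Require Import all_boot all_order all_algebra.
From mathcomp Require Import all_classical all_reals all_analysis.

Set Implicit Arguments.
Unset Strict Implicit.
Unset Printing Implicit Defensive.

Import Order.TTheory GRing.Theory Num.Theory.
Local Open Scope classical_set_scope.
Local Open Scope ring_scope.

(* The library norm on 'cV[R]_n is the sup norm, hence this definition. *)
Definition euclidean_norm (R : realType) (n : nat) (x : 'cV[R]_n) : R :=
  Num.sqrt (\sum_(i < n) x i 0 ^+ 2).

Definition unit_sphere (R : realType) (n : nat) : set 'cV[R]_n :=
  [set x | euclidean_norm x = 1].
Arguments unit_sphere {R n}.

Definition nonneg_homogeneous (R : realType) (n : nat) (f : 'cV[R]_n -> R) :
    Prop :=
  forall (a : R) (x : 'cV[R]_n), 0 <= a -> f (a *: x) = a * f x /\ 0 <= a * f x.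

Definition subdifferential (R : realType) (n : nat) (f : 'cV[R]_n -> R)
    (x : 'cV[R]_n) : set 'cV[R]_n :=
  [set v | forall y : 'cV[R]_n, f x + (v^T *m (y - x)) 0 0 <= f y].

Definition Omega (R : realType) (n : nat) (B : 'cV[R]_n -> R) : set 'cV[R]_n :=
  [set x | B x != 0].

(* Total because of the convention y / 0 = 0; meaningful only on Omega B. *)
Definition quotient_functional (R : realType) (n : nat) (T B : 'cV[R]_n -> R)
    (x : 'cV[R]_n) : R :=
  T x / B x.

Definition sphere_ball (R : realType) (n : nat) (B : 'cV[R]_n -> R)
    (xs : 'cV[R]_n) (eps : R) : set 'cV[R]_n :=
  [set x | (unit_sphere `&` Omega B) x /\ euclidean_norm (x - xs) <= eps].

Definition local_minimizer (R : realType) (n : nat) (T B : 'cV[R]_n -> R)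
    (xs : 'cV[R]_n) : Prop :=
  (unit_sphere `&` Omega B) xs /\
  exists2 eps : R, 0 < eps &
    forall x, sphere_ball B xs eps x -> quotient_functional T B xs <= quotient_functional T B x.

(* Main.v *)
(* For [v] in both subdifferentials, [h x - h xs <= v . (x - xs) <= T x - T xs].
   Since [h xs = T xs], this gives [E(xs) B x <= T x]. *)
Require Import Defs.
From mathcomp Require Import all_boot all_order all_algebra.
From mathcomp Require Import all_classical all_reals all_analysis.
From mathcomp Require Import lra.

Import Order.TTheory GRing.Theory Num.Theory.
Local Open Scope classical_set_scope.
Local Open Scope ring_scope.

Theorem theorem3p2 (R : realType) (n : nat) (T B : 'cV[R]_n -> R)
  (convT : @convex_function R 'cV[R]_n setT T)
  (convB : @convex_function R 'cV[R]_n setT B)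
  (homT : nonneg_homogeneous T)
  (homB : nonneg_homogeneous B)
  (zeroBT : [set x | B x = 0] `&` [set x | T x = 0] = [set 0])
  (Omega_nonempty : Omega B !=set0)
  (xs : 'cV[R]_n)
  (xs_in : (unit_sphere `&` Omega B) xs) :
  let g := fun x : 'cV[R]_n => T x in
  let h := fun x : 'cV[R]_n => quotient_functional T B xs * B x in
  (exists2 eps : R, 0 < eps &
    forall x, sphere_ball B xs eps x ->
      subdifferential h x `&` subdifferential g xs !=set0) ->
  local_minimizer T B xs.
Proof.
move=> g h [eps eps_gt0 subdiffs_meet]; split=> //.
exists eps => // x x_near.
have [v [v_h v_g]] := subdiffs_meet x x_near.
have [[[_ /= Bx_neq0] _] [_ /= Bxs_neq0]] := (x_near, xs_in).
(* Nonnegativity of [B] is the second half of [homB], taken with factor 1. *)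
have Bx_gt0 : 0 < B x.
  by rewrite lt_neqAle eq_sym Bx_neq0; have [_] := homB 1 x ler01; rewrite mul1r.
have h_xs : h xs = T xs by rewrite /h /quotient_functional divfK.
(* The subgradient inequality of [h] is based at [x] and tested at [xs]; flipping the sign makes its
   linear term the one in [g_le]. *)
have := v_h xs; rewrite h_xs -(opprB x xs) mulmxN mxE => h_le.
have g_le := v_g x.
(* Clearing the denominator leaves [h x <= T x], the sum of [h_le] and [g_le], where the linear
   terms cancel. *)
rewrite [leRHS]/quotient_functional ler_pdivlMr //.
rewrite -/(h x); move: h_le g_le; rewrite /g; lra.
Qed.
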